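(* Let $f_{i,t}$, $i\in\mathcal V=\{1,\dots,m\}$, $t\ge 1$, be generated by the distributed functional mirror descent (DFMD) algorithm described in the context, where: (i) the network satisfies the graph assumption: each $P_t$ is doubly stochastic; there is an integer $B\ge 1$ such that the graph $(\mathcal V,\mathcal E_{kB+1}\cup\cdots\cup\mathcal E_{(k+1)B})$ is strongly connected for every $k\ge 0$; and there is $0<\zeta<1$ with $[P_t]_{ii}\ge\zeta$ for all $i,t$ and $[P_t]_{ij}\ge\zeta$ whenever $(j,i)\in\mathcal E_t$; (ii) there is a constant $G$ such that $\|\partial_f\mathbf J_i\|_{\mathcal B^*}\le G$ for all $f\in\mathcal W$ and $i\in\mathcal V$; (iii) for every $f\in\mathcal B$, all $g_1,\dots,g_m\in\mathcal B$ and all $a_j\ge 0$ with $\sum_{j=1}^m a_j=1$, one has $D_{\mathbf\Psi}\big(f\|\sum_{j=1}^m a_jg_j\big)\le\sum_{j=1}^m a_jD_{\mathbf\Psi}(f\|g_j)$. For a total number of iterations $T\ge 1$, run DFMD with constant stepsize $\eta=\frac{1}{\sqrt T}$ and, for $\ell\in\mathcal V$, set $\widetilde f_{\ell,T}=\frac1T\sum_{t=1}^T f_{\ell,t}$. Then for every $\ell\in\mathcal V$, $$\mathbf J(\widetilde f_{\ell,T})-\mathbf J(f^* )\le\mathcal O\Big(\frac{1}{\sqrt T}\Big),$$ i.e. there is a constant $C>0$ independent of $T$ such that $\mathbf J(\widetilde f_{\ell,T})-\mathbf J(f^* )\le C/\sqrt T$ for all $T\ge 1$ (the initial points $f_{i,1}$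 being fixed independently of $T$).
   Context: $(\mathcal B,\|\cdot\|_{\mathcal B})$ is a real reflexive Banach space with dual $(\mathcal B^*,\|\cdot\|_{\mathcal B^*})$, and $\langle f,\mathbf F\rangle_{\mathcal B\times\mathcal B^*}=\mathbf F(f)$ for $f\in\mathcal B$, $\mathbf F\in\mathcal B^*$. $\mathcal W\subseteq\mathcal B$ is a nonempty closed convex set (possibly unbounded). Problem: minimize $\mathbf J(f)=\sum_{i=1}^m\mathbf J_i(f)$ over $f\in\mathcal W$, where each $\mathbf J_i:\mathcal B\to\mathbb R$ is convex and Gâteaux differentiable. For a Gâteaux differentiable convex functional $\mathbf F$, $\partial_f\mathbf F\in\mathcal B^*$ denotes its Gâteaux derivative (its unique subgradient) at $f$. $f^*\in\mathcal W$ denotes a minimizer, assumed to exist: $\mathbf J(f)\ge\mathbf J(f^* )$ for all $f\in\mathcal W$. Network: for each $t\ge1$, $P_t$ is an $m\times m$ matrix with nonnegative entries $[P_t]_{ij}$, and $\mathcal E_t=\{(j,i)\in\mathcal V\times\mathcal V:[P_t]_{ij}>0\}$. Mirror map: $\mathbf\Psi:\mathcal B\to\mathbb R$ is proper, coercive, strictly convex, Gâteaux differentiable, with subgradient sets at distinct points disjoint and $\partial_{(\cdot)}\mathbf\Psi(\mathcal B)=\mathcal B^*$ (so $\partial_{(\cdot)}\mathbf\Psi:\mathcal B\to\mathcal B^*$ is bijective), and $\sigma_{\mathbf\Psi}$-strongly convex with $\sigma_{\mathbf\Psi}>0$: $\mathbf\Psi(f)-\mathbf\Psi(f_0)\ge\langle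 f-f_0,\partial_{f_0}\mathbf\Psi\rangle_{\mathcal B\times\mathcal B^*}+\frac{\sigma_{\mathbf\Psi}}2\|f-f_0\|_{\mathcal B}^2$ for all $f,f_0\in\mathcal B$. The Bregman divergence is $D_{\mathbf\Psi}(f_1\|f_2)=\mathbf\Psi(f_1)-\mathbf\Psi(f_2)-\langle f_1-f_2,\partial_{f_2}\mathbf\Psi\rangle_{\mathcal B\times\mathcal B^*}$, and the projection map is $\Pi_{\mathcal W,\mathbf\Psi}(f')=\arg\min_{f\in\mathcal W}D_{\mathbf\Psi}(f\|f')$ (the unique minimizer). DFMD algorithm with constant stepsize $\eta>0$ and initial points $f_{i,1}\in\mathcal W$: for $t\ge1$, $i\in\mathcal V$, $g_{i,t}=\partial_{f_{i,t}}\mathbf\Psi$, $\ h_{i,t}=g_{i,t}-\eta\,\partial_{f_{i,t}}\mathbf J_i$, $\ \widehat f_{i,t+1}=\Pi_{\mathcal W,\mathbf\Psi}\big((\partial\mathbf\Psi)^{-1}(h_{i,t})\big)$, $\ f_{i,t+1}=\sum_{j=1}^m[P_t]_{ij}\widehat f_{j,t+1}$. *)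

(* Defs.v *)
From HB Require Import structures.
From mathcomp Require Import all_boot all_order all_algebra.
From mathcomp Require Import boolp classical_sets functions reals constructive_ereal.
From mathcomp Require Import interval_inference topology normedtype derive convex.

Set Implicit Arguments.
Unset Strict Implicit.
Unset Printing Implicit Defensive.

Import Order.TTheory GRing.Theory Num.Theory.
Import numFieldNormedType.Exports.

Local Open Scope classical_set_scope.
Local Open Scope ring_scope.

Definition dual_pred (R : realType) (B : normedModType R) : {pred B -> R} :=
  mem [set F : B -> R | linear F /\ continuous F].

Record dual (R : realType) (B : normedModType R) := Dual {
  dual_val :> B -> R;
  dual_valP : dual_val \in @dual_pred R B }.

(* The topological dual carries the dual norm, the supremum of the absolute
   value over the closed unit ball; this makes it a normed module itself, so
   that the bidual is simply [dual (dual B)]. *)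
Section DualNormedModule.
Context (R : realType) (B : normedModType R).

HB.instance Definition _ := [isSub for @dual_val R B].
HB.instance Definition _ := [Choice of dual B by <:].

Lemma dual_submod_closed : submod_closed (@dual_pred R B).
Proof.
split.
  rewrite inE; split; last exact: cst_continuous.
  by move=> a x y; rewrite [RHS](_ : _ = a *: 0 + 0) ?scaler0 ?addr0.
move=> a F G; rewrite !inE => -[lF cF] [lG cG]; split.
  move=> k x y; transitivity (a *: F (k *: x + y) + G (k *: x + y)) => //.
  rewrite lF lG [RHS](_ : _ = k *: (a *: F x + G x) + (a *: F y + G y))//.
  by rewrite !scalerDr !scalerA mulrC -!addrA; congr (_ + _); rewrite addrCA.
by move=> x; apply: (cvgD (cvgZr (cF x)) (cG x)).
Qed.

HB.instance Definition _ := GRing.isSubmodClosed.Build R (B -> R)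
  (@dual_pred R B) dual_submod_closed.
HB.instance Definition _ := [SubChoice_isSubLmodule of dual B by <:].

Lemma dual_linear (F : dual B) : linear F.
Proof. by case: F => F /=; rewrite inE => -[]. Qed.

HB.instance Definition _ (F : dual B) :=
  GRing.isLinear.Build R B R *:%R F (dual_linear F).

Lemma dual_continuous (F : dual B) : continuous F.
Proof. by case: F => F /=; rewrite inE => -[]. Qed.

Definition dual_norm (F : dual B) : R :=
  sup [set `|F f| | f in [set f : B | `|f| <= 1]].

Lemma dual_norm_has_sup (F : dual B) :
  has_sup [set `|F f| | f in [set f : B | `|f| <= 1]].
Proof.
split; first by exists `|F 0|; exists 0 => //=; rewrite normr0.
have /bounded_funP/(_ 1)[M FM] :=
  @continuous_linear_bounded _ _ _ 0 F (@dual_continuous F 0).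
by exists M => _ [f /= f1 <-]; exact: FM.
Qed.

Lemma dual_normD (F G : dual B) : dual_norm (F + G) <= dual_norm F + dual_norm G.
Proof.
apply: ge_sup; first exact: (dual_norm_has_sup _).1.
move=> _ [f f1 <-]; rewrite (le_trans (ler_normD _ _))// lerD//.
- by apply: ub_le_sup; [exact: (dual_norm_has_sup F).2|exists f].
- by apply: ub_le_sup; [exact: (dual_norm_has_sup G).2|exists f].
Qed.

Lemma dual_normZ (a : R) (F : dual B) : dual_norm (a *: F) = `|a| * dual_norm F.
Proof.
have le_normZ b (H : dual B) : dual_norm (b *: H) <= `|b| * dual_norm H.
  apply: ge_sup; first exact: (dual_norm_has_sup _).1.
  move=> _ [f f1 <-]; rewrite [_ f]/(b *: H f) normrZ ler_wpM2l//.
  by apply: ub_le_sup; [exact: (dual_norm_has_sup H).2|exists f].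
apply/eqP; rewrite eq_le le_normZ/=; have [->|a0] := eqVneq a 0.
  rewrite normr0 mul0r; apply: ub_le_sup; first exact: (dual_norm_has_sup _).2.
  by exists 0 => /=; rewrite ?normr0//; apply/normr0P/eqP; exact: linear0.
rewrite -ler_pdivlMl ?normr_gt0// -normfV.
by apply: le_trans (le_normZ _ _); rewrite scalerA mulVf// scale1r.
Qed.

Lemma dual_norm_eq0 (F : dual B) : dual_norm F = 0 -> F = 0.
Proof.
move=> F0; apply/val_inj/funext => f /=; apply/eqP.
have [->|f0] := eqVneq f 0; first by rewrite linear0.
have : `|F (`|f|^-1 *: f)| <= 0.
  rewrite -F0; apply: ub_le_sup; first exact: (dual_norm_has_sup F).2.
  exists (`|f|^-1 *: f) => //=.
  by rewrite normrZ normfV normr_id mulVf// normr_eq0.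
rewrite normr_le0 linearZ/= -[_ *: _]/(_ * _) mulf_eq0 invr_eq0 normr_eq0.
by rewrite (negPf f0).
Qed.

HB.instance Definition _ := Lmodule_isNormed.Build R (dual B)
  dual_normD dual_normZ dual_norm_eq0.

End DualNormedModule.

Definition reflexive_space (R : realType) (B : normedModType R) : Prop :=
  forall Phi : dual (dual B), exists f : B, forall F : dual B, Phi F = F f.

Section ConvexAnalysis.
Context (R : realType) (B : normedModType R).
Implicit Types (J Psi : B -> R) (F : dual B).

Definition is_gateaux J (f : B) F : Prop :=
  forall v : B, is_derive f v J (F v).

Definition gateaux_differentiable J : Prop :=
  forall f, exists F, is_gateaux J f F.

(* The Gateaux derivative, unique when it exists. *)
Definition gateaux J (f : B) : dual B := xget 0 [set F | is_gateaux J f F].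

Definition subdifferential J (f : B) : set (dual B) :=
  [set F | forall g, J f + F (g - f) <= J g].

Definition proper_functional (E : B -> \bar R) : Prop :=
  (forall f, E f != -oo%E) /\ (exists f, E f != +oo%E).

Definition coercive J : Prop :=
  forall A : R, exists r : R, forall f : B, r <= `|f| -> A <= J f.

Definition strictly_convex J : Prop :=
  forall (t : R) (f g : B), 0 < t < 1 -> f != g ->
    J (t *: f + (1 - t) *: g) < t * J f + (1 - t) * J g.

Definition strongly_convex (sigma : R) J : Prop :=
  forall f f0, gateaux J f0 (f - f0) + sigma / 2 * `|f - f0| ^+ 2 <= J f - J f0.

Record mirror_map (sigma : R) Psi : Prop := MirrorMap {
  mirror_proper : proper_functional (EFin \o Psi);
  mirror_coercive : coercive Psi;
  mirror_strictly_convex : strictly_convex Psi;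
  mirror_gateaux : gateaux_differentiable Psi;
  mirror_disjoint : forall f g, f != g ->
    subdifferential Psi f `&` subdifferential Psi g = set0;
  mirror_surjective : range (gateaux Psi) = [set: dual B];
  mirror_strongly_convex : strongly_convex sigma Psi }.

Definition bregman Psi (f1 f2 : B) : R :=
  Psi f1 - Psi f2 - gateaux Psi f2 (f1 - f2).

Definition is_bregman_proj (W : set B) Psi (f' f : B) : Prop :=
  W f /\ forall g, W g -> bregman Psi f f' <= bregman Psi g f'.

(* The unique minimizer of [bregman Psi _ f'] over [W]. *)
Definition bregman_proj (W : set B) Psi (f' : B) : B :=
  xget f' [set f | is_bregman_proj W Psi f' f].

Definition mirror_inv Psi (h : dual B) : B :=
  'pinv_(fun=> 0) [set: B] (gateaux Psi) h.

End ConvexAnalysis.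

Section Network.
Context (R : realType) (m : nat).

Definition doubly_stochastic (A : 'M[R]_m) : Prop :=
  [/\ forall i j, 0 <= A i j,
      forall i, \sum_j A i j = 1 &
      forall j, \sum_i A i j = 1].

Definition edge (A : 'M[R]_m) : rel 'I_m := fun j i => 0 < A i j.

Definition strongly_connected (e : rel 'I_m) : Prop :=
  forall i j, connect e i j.

(* [P t] is only used for [t >= 1]; the window [k * b + s.+1], [s < b], is
   [k b + 1, ..., (k + 1) b]. *)
Definition graph_assumption (P : nat -> 'M[R]_m) (b : nat) (zeta : R) : Prop :=
  [/\ forall t, (1 <= t)%N -> doubly_stochastic (P t),
      (1 <= b)%N /\ forall k : nat, strongly_connected
        (fun j i => [exists s : 'I_b, edge (P (k * b + s.+1)%N) j i]),
      0 < zeta < 1,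
      forall t i, (1 <= t)%N -> zeta <= P t i i &
      forall t i j, (1 <= t)%N -> edge (P t) j i -> zeta <= P t i j].

End Network.

Section Algorithm.
Context (R : realType) (B : normedModType R) (m : nat).
Variables (W : set B) (Psi : B -> R) (J : 'I_m -> B -> R).
Variables (P : nat -> 'M[R]_m) (eta : R) (f1 : 'I_m -> B).

Definition dfmd_local (f : 'I_m -> B) (i : 'I_m) : B :=
  let g := gateaux Psi (f i) in
  let h := g - eta *: gateaux (J i) (f i) in
  bregman_proj W Psi (mirror_inv Psi h).

(* [dfmd t i] is the iterate f_{i,t}, for [t >= 1]; the value at [t = 0] is a
   dummy. *)
Fixpoint dfmd (t : nat) : 'I_m -> B :=
  match t with
  | (_.+1 as t').+1 => fun i => \sum_j P t' i j *: dfmd_local (dfmd t') j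
  | _ => f1
  end.

Definition dfmd_average (T : nat) (l : 'I_m) : B :=
  T%:R^-1 *: \sum_(1 <= t < T.+1) dfmd t l.

End Algorithm.

(* Main.v *)
Require Import Defs.
From HB Require Import structures.
From mathcomp Require Import all_boot all_order all_algebra.
From mathcomp Require Import ring lra.
From mathcomp Require Import boolp classical_sets functions reals constructive_ereal.
From mathcomp Require Import interval_inference topology normedtype derive convex.

Set Implicit Arguments.
Unset Strict Implicit.
Unset Printing Implicit Defensive.

Import Order.TTheory GRing.Theory Num.Theory.
Import numFieldNormedType.Exports.

Local Open Scope classical_set_scope.
Local Open Scope ring_scope.

(** The proof combines a regret bound for mirror descent with a consensus bound
    for the network; both are of order [1 / sqrt T] once [eta = 1 / sqrt T].

    Regret.  Let [q] be the iterate of agent [i] at time [t] and [p] its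
    projected mirror step.  The first-order optimality condition of the Bregman
    projection and the three-point identity for [D = bregman Psi] give
    [eta * J_i'(q) (p - f) <= D f q - D f p - D p q] for every [f] in [W]
    ([mirror_step]).  Strong convexity bounds [D p q] below by a multiple of
    [|p - q|^2], and Young's inequality absorbs the change from [p] to [q] on
    the left into an error of order [eta^2] ([mirror_step_regret]).  By
    separate convexity of the divergence and double stochasticity, mixing does
    not increase the sum over the agents of [D fstar], so these inequalities
    telescope over [t] ([dfmd_regret]): the regret of the agents, each evaluated at its own
    iterate, is at most [O(1 / eta + T * eta)].

    Consensus.  The same inequality with [f := q] shows that a mirror step
    moves an agent by at most [eta * G / sigma] ([mirror_step_move]).  The
    iterates thus follow the linear averaging dynamics up to an error of order
    [eta] per step.  A product of [mixing_time] consecutive mixing matrices has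
    all its entries above a fixed positive constant ([transition_ge]), because
    during each connectivity window the set of agents reached by a given one
    gains a member.  Such a product contracts the diameter of a family of
    points by a fixed factor ([mix_contract]); hence the sum over [t <= T] of
    the diameters is [O(1 + T * eta)] ([sum_diam]).

    The gradient bound makes each [J_i] Lipschitz along [W], so replacing the
    agents' own iterates by those of agent [l] costs at most a multiple of
    that sum ([dfmd_agent_regret]).  Jensen's inequality ([convex_average])
    then passes to the time average.

    The Bregman projection exists because a minimizing sequence is Cauchy:
    strong convexity gives a parallelogram inequality for the divergence
    ([bregman_midpoint]), and completeness provides the limit. *)

(** * Gateaux derivatives of convex functionals and Bregman divergences *)

Section Gateaux.
Context (R : realType) (B : normedModType R).
Implicit Types (J Psi : B -> R) (F G : dual B) (W : set B).

Lemma dual_subE F G v : (F - G) v = F v - G v.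
Proof. by []. Qed.

Lemma dual_scaleE (a : R) F v : (a *: F) v = a * F v.
Proof. by []. Qed.

Lemma dual_linearB F v w : F (v - w) = F v - F w.
Proof. exact: linearB. Qed.

Lemma dual_linear_comb F (s t : R) v w :
  F (s *: v + t *: w) = s * F v + t * F w.
Proof. by rewrite linearD !linearZ. Qed.

Lemma dual_le_norm F v : `|F v| <= `|F| * `|v|.
Proof.
have [->|v0] := eqVneq v 0; first by rewrite linear0 !normr0 mulr0.
have nv0 : 0 < `|v| by rewrite normr_gt0.
rewrite -ler_pdivrMr//.
have -> : `|F v| / `|v| = `|F (`|v|^-1 *: v)|.
  by rewrite linearZ/= normrM normfV normr_id mulrC.
apply: ub_le_sup; first exact: (dual_norm_has_sup F).2.
exists (`|v|^-1 *: v) => //=.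
by rewrite normrZ normfV normr_id mulVf// gt_eqF.
Qed.

Lemma gateauxP J f : gateaux_differentiable J -> is_gateaux J f (gateaux J f).
Proof. by move=> /(_ f); exact: xgetPex. Qed.

(** Constraining [J] only for [0 < s <= 1] matches what convexity of a set or of
    a functional provides; the one-sided difference quotients suffice since the
    two-sided limit exists. *)
Lemma ge_derive J (f v : B) (l c : R) : is_derive f v J l ->
  (forall s, 0 < s -> s <= 1 -> J f + s * c <= J (s *: v + f)) -> c <= l.
Proof.
move=> [Jfv <-] Jc; pose q (h : R) : R := h^-1 *: (J (h *: v + f) - J f).
apply: (cvgr_to_ge (f := q) (F := 0^'+)).
  by apply: cvg_dnbhs_at_right; exact: Jfv.
near=> s.
have s0 : 0 < s by near: s; exact: nbhs_right_gt.
have s1 : s <= 1 by near: s; exact: nbhs_right_le.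
rewrite /q -[_ *: _]/(_ * _) mulrC ler_pdivlMr// mulrC lerBrDl.
exact: Jc.
Unshelve. all: by end_near. Qed.

Lemma le_derive J (f v : B) (l c : R) : is_derive f v J l ->
  (forall s, 0 < s -> s <= 1 -> J (s *: v + f) <= J f + s * c) -> l <= c.
Proof.
move=> Jl Jc; rewrite -lerN2; apply: (ge_derive (is_deriveN Jl)) => s s0 s1.
by rewrite [(- J) f]/(- _) [(- J) _]/(- _) mulrN -opprD lerN2; exact: Jc.
Qed.

Lemma convex_lineP J x y (s : R) : convex_function [set: B] J ->
  0 <= s -> s <= 1 -> J (s *: x + (1 - s) *: y) <= s * J x + (1 - s) * J y.
Proof.
move=> Jc s0 s1.
have s01 : 0 <= s <= 1 by rewrite s0.
have /= := Jc (Itv01 s0 s1) x y.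
by rewrite !inE; apply.
Qed.

Lemma convex_set_lineP W x y (s : R) : convex_set W -> W x -> W y ->
  0 <= s -> s <= 1 -> W (s *: x + (1 - s) *: y).
Proof.
move=> Wc Wx Wy s0 s1.
have /= := Wc x y (Itv01 s0 s1).
by rewrite !inE; apply.
Qed.

Lemma convex_subgradient J f g :
  convex_function [set: B] J -> gateaux_differentiable J ->
  J f + gateaux J f (g - f) <= J g.
Proof.
move=> Jc Jd; rewrite -lerBrDl.
apply: (le_derive (gateauxP f Jd (g - f))) => s s0 s1.
have -> : s *: (g - f) + f = s *: g + (1 - s) *: f.
  by rewrite scalerBr scalerBl scale1r addrAC addrA.
by rewrite (le_trans (convex_lineP _ _ Jc (ltW s0) s1))//; lra.
Qed.

Lemma bregman_three_point Psi f p q : bregman Psi f q =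
  bregman Psi f p + bregman Psi p q + (gateaux Psi p - gateaux Psi q) (f - p).
Proof. by rewrite /bregman dual_subE !dual_linearB; ring. Qed.

Lemma bregmanxx Psi f : bregman Psi f f = 0.
Proof. by rewrite /bregman !subrr linear0 subrr. Qed.

Lemma bregman_ge sigma Psi f g : strongly_convex sigma Psi ->
  sigma / 2 * `|f - g| ^+ 2 <= bregman Psi f g.
Proof. by move=> /(_ f g); rewrite /bregman; lra. Qed.

Lemma bregman_ge0 sigma Psi f g : 0 < sigma -> strongly_convex sigma Psi ->
  0 <= bregman Psi f g.
Proof.
move=> s0 Psic; rewrite (le_trans _ (bregman_ge f g Psic))//.
by rewrite mulr_ge0 ?exprn_ge0// divr_ge0 ?ltW.
Qed.

(** The parallelogram inequality of a strongly convex functional: the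
    three-point identity at the midpoint [z], applied to [x] and to [y], has opposite linear
    terms because [x - z = - (y - z)]. *)
Lemma bregman_midpoint sigma Psi x y q : strongly_convex sigma Psi ->
  sigma / 4 * `|x - y| ^+ 2 + 2 * bregman Psi (2^-1 *: x + (1 - 2^-1) *: y) q
  <= bregman Psi x q + bregman Psi y q.
Proof.
move=> Psic; set z := (X in bregman Psi X q).
have xz : x - z = 2^-1 *: (x - y).
  have -> : x - z = (1 - 2^-1) *: x - (1 - 2^-1) *: y.
    by rewrite scalerBl scale1r /z opprD addrA.
  by rewrite -scalerBr; congr (_ *: _); field.
have yz : y - z = - (x - z).
  rewrite xz -scalerN opprB /z.
  have -> : y - (2^-1 *: x + (1 - 2^-1) *: y) = 2^-1 *: y - 2^-1 *: x.
    rewrite scalerBl scale1r opprD opprB !addrA.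
    by rewrite addrC !addrA addrAC addNr add0r.
  by rewrite -scalerBr.
rewrite (bregman_three_point _ x z) (bregman_three_point _ y z) yz linearN/=.
have := bregman_ge x z Psic; have := bregman_ge y z Psic.
by rewrite yz normrN xz normrZ exprMn ger0_norm ?invr_ge0//; lra.
Qed.

End Gateaux.

(** * The projected mirror step *)

Section Projection.
Context (R : realType) (B : completeNormedModType R).
Variables (W : set B) (Psi : B -> R) (sigma : R).
Hypotheses (W_neq0 : W !=set0) (W_closed : closed W) (W_convex : convex_set W).
Hypotheses (sigma_gt0 : 0 < sigma) (Psi_sc : strongly_convex sigma Psi).

(** By the midpoint inequality a minimizing sequence [u] in [W] is Cauchy: the
    divergence at the midpoint of [u n] and [u k] is at least the infimum, which
    forces [u n] and [u k] together.  The limit stays in the closed set [W]. *)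
Lemma bregman_proj_exists q : exists p, is_bregman_proj W Psi q p.
Proof.
pose D x := bregman Psi x q.
pose I := inf (D @` W).
have DW : has_inf (D @` W).
  split; first by case: W_neq0 => x Wx; exists (D x), x.
  by exists 0 => _ [x _ <-]; exact: bregman_ge0 sigma_gt0 Psi_sc.
have I_le x : W x -> I <= D x.
  by move=> Wx; apply: ge_inf; [exact: DW.2 | exists x].
have [v v_gt0 v_small] : exists2 v : nat -> R, (forall n, 0 < v n) &
    forall e, 0 < e -> \forall n \near \oo, v n < e.
  exists (fun n => n.+1%:R^-1) => [n|e e0]; first by rewrite invr_gt0.
  exact: (near_infty_natSinv_lt (PosNum e0)).
have /choice[u uP] (n : nat) : exists x, W x /\ D x < I + v n.
  by have [_ [x Wx <-] xI] := inf_adherent (v_gt0 n) DW; exists x.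
have uu n k : sigma / 4 * `|u n - u k| ^+ 2 <= v n + v k.
  have [Wn Dn] := uP n; have [Wk Dk] := uP k.
  have := bregman_midpoint (u n) (u k) q Psi_sc.
  have : I <= D (2^-1 *: u n + (1 - 2^-1) *: u k).
    by apply: I_le; apply: convex_set_lineP => //; lra.
  by move: Dn Dk; rewrite /D; lra.
have : cvg (u @ \oo).
  apply/cauchy_cvgP/cauchy_exP => e e0.
  have s0 : 0 < sigma / 8 * e ^+ 2.
    by rewrite mulr_gt0 ?exprn_gt0// divr_gt0.
  have [N _ NP] := v_small _ s0.
  exists (u N); exists N => // n /= Nn; rewrite -ball_normE /=.
  rewrite -(ltr_pXn2r (n := 2))// ?nnegrE ?(ltW e0)//.
  rewrite -(ltr_pM2l (x := sigma / 4)) ?divr_gt0//.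
  rewrite (le_lt_trans (uu N n))//.
  have := NP N (leqnn N); have := NP n Nn => /=; lra.
move=> /cvg_ex[p up]; exists p.
have Wp : W p.
  by apply: (closed_cvg _ W_closed _ _ up); apply: nearW => n; exact: (uP n).1.
split=> // g Wg; apply: le_trans (I_le g Wg); rewrite -/(D p).
(* Lower semicontinuity at the limit [p]: the divergence lies above its affine
   minorant at [p], whose linear part [F] is continuous. *)
pose F := gateaux Psi p - gateaux Psi q.
have FD n : D p <= D (u n) - F (u n - p).
  rewrite /D (bregman_three_point Psi (u n) p q).
  by have := bregman_ge0 (u n) p sigma_gt0 Psi_sc; rewrite /F; lra.
have Fu : F (u n - p) @[n --> \oo] --> (0 : R).
  rewrite -[0 in X in _ --> X](linear0 F) -(subrr p).
  apply: continuous_cvg; first exact: dual_continuous.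
  exact: cvgB up (cvg_cst p).
apply/ler_addgt0Pr => e e0.
have e2 : 0 < e / 2 by rewrite divr_gt0.
have [N _ NP] := v_small _ e2.
near \oo => n.
have := FD n; have := (uP n).2.
have : v n < e / 2 by near: n; exact: v_small.
suff : `|F (u n - p)| < e / 2 by rewrite ltr_norml => /andP[+ _]; lra.
near: n; apply: (cvgr0_norm_lt _ Fu).
Unshelve. all: by end_near. Qed.

Lemma bregman_projP q : is_bregman_proj W Psi q (bregman_proj W Psi q).
Proof. by apply: xgetPex; exact: bregman_proj_exists. Qed.

End Projection.

Lemma mirror_invK (R : realType) (B : normedModType R) (Psi : B -> R) h :
  range (gateaux Psi) = [set: dual B] ->
  gateaux Psi (mirror_inv Psi h) = h.
Proof. by move=> Psi_surj; apply: pinvK; rewrite Psi_surj inE. Qed.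

Section MirrorStep.
Context (R : realType) (B : normedModType R).
Variables (W : set B) (Psi : B -> R) (sigma : R).
Hypotheses (W_convex : convex_set W).
Hypotheses (sigma_gt0 : 0 < sigma) (Psi_sc : strongly_convex sigma Psi).
Hypothesis Psi_gateaux : gateaux_differentiable Psi.

(** Euler's inequality for the projection: along the segment from [p] to [f],
    which stays in [W], the divergence cannot decrease at [p]. *)
Lemma bregman_proj_variational q p f : is_bregman_proj W Psi q p -> W f ->
  0 <= (gateaux Psi p - gateaux Psi q) (f - p).
Proof.
move=> [Wp pmin] Wf; rewrite dual_subE subr_ge0.
apply: (ge_derive (gateauxP p Psi_gateaux (f - p))) => s s0 s1.
have -> : s *: (f - p) + p = s *: f + (1 - s) *: p.
  by rewrite scalerBr scalerBl scale1r addrAC addrA.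
have := pmin _ (convex_set_lineP W_convex Wf Wp (ltW s0) s1).
rewrite /bregman !dual_linearB dual_linear_comb; lra.
Qed.

Variables (eta G : R) (F : dual B) (q q' p : B).
Hypotheses (eta_ge0 : 0 <= eta) (F_le : `|F| <= G).
Hypothesis q'E : gateaux Psi q' = gateaux Psi q - eta *: F.
Hypotheses (Wq : W q) (p_proj : is_bregman_proj W Psi q' p).

(** Here [q'] is the unprojected step from [q] along the gradient [F] and [p]
    its projection, so the optimality condition at [p] controls [F] through the
    three-point identity. *)
Lemma mirror_step f : W f ->
  eta * F (p - f) <= bregman Psi f q - bregman Psi f p - bregman Psi p q.
Proof.
move=> Wf; have := bregman_proj_variational p_proj Wf.
rewrite (bregman_three_point Psi f p q) q'E !dual_subE dual_scaleE.
by rewrite !dual_linearB; lra.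
Qed.

Let G_ge0 : 0 <= G. Proof. exact: le_trans F_le. Qed.

Let F_ge v : - (G * `|v|) <= F v.
Proof.
have : `|F v| <= G * `|v|.
  by rewrite (le_trans (dual_le_norm F v))// ler_wpM2r.
by rewrite ler_norml => /andP[].
Qed.

(** [mirror_step] at [f := q] bounds [bregman q p + bregman p q], hence
    [sigma * |p - q| ^ 2], by [eta * G * |p - q|]. *)
Lemma mirror_step_move : `|p - q| <= eta * G / sigma.
Proof.
have := mirror_step Wq; rewrite bregmanxx.
have := bregman_ge p q Psi_sc; have := bregman_ge q p Psi_sc.
rewrite [`|q - p|]distrC => h1 h2 h3.
have := ler_wpM2l eta_ge0 (F_ge (p - q)) => h4.
rewrite ler_pdivlMr//.
have [->|pq0] := eqVneq (`|p - q|) 0; first by rewrite mul0r mulr_ge0.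
have pq : 0 < `|p - q| by rewrite lt_neqAle eq_sym pq0/=.
rewrite -(ler_pM2l pq); move: h1 h2 h3 h4; lra.
Qed.

Lemma mirror_step_regret f : W f -> eta * F (q - f) <=
  bregman Psi f q - bregman Psi f p + eta ^+ 2 * (G ^+ 2 / (2 * sigma)).
Proof.
move=> Wf; have := mirror_step Wf.
have := bregman_ge p q Psi_sc.
have := ler_wpM2l eta_ge0 (F_ge (p - q)).
(* Young's inequality for the product of [eta * G] and [`|p - q|]. *)
have : 0 <= (sigma * `|p - q| - eta * G) ^+ 2 / (2 * sigma).
  by rewrite divr_ge0 ?sqr_ge0// mulr_ge0// ltW.
have -> : (sigma * `|p - q| - eta * G) ^+ 2 / (2 * sigma) =
    sigma / 2 * `|p - q| ^+ 2 - eta * G * `|p - q|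
    + eta ^+ 2 * (G ^+ 2 / (2 * sigma)).
  by field; rewrite gt_eqF.
by rewrite !dual_linearB; lra.
Qed.

End MirrorStep.

(** * Reachability in a time-varying graph *)

Lemma connect_exit (T : finType) (e : rel T) (S : {set T}) x y :
  connect e x y -> x \in S -> y \notin S ->
  exists u v, [/\ u \in S, v \notin S & e u v].
Proof.
move=> /connectP[p + ->]; elim: p x => [x _ /= -> //|z p IHp x /=].
move=> /andP[xz zp] xS; have [zS|zS _] := boolP (z \in S); first exact: IHp.
by exists x, z.
Qed.

Section Spread.
Variables (m b : nat) (e : nat -> rel 'I_m).
Hypothesis connected_window : forall k : nat, strongly_connected
  (fun j i => [exists s : 'I_b, e (k * b + s.+1)%N j i]).

(** [S] is the set of agents reached from [i0].  As long as an agent is missing,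
    strong connectivity of a window yields an edge leaving [S] somewhere in the
    window, so each full window adds a member.  The delay consists of [m]
    windows of length [b], of at most [b] steps until the next window begins,
    and of one more step because windows begin at times [k * b + 1]. *)
Lemma spread_everywhere (S : nat -> {set 'I_m}) (t0 : nat) (i0 : 'I_m) :
  (0 < b)%N -> i0 \in S t0 ->
  (forall t, (t0 <= t)%N -> S t \subset S t.+1) ->
  (forall t i j, (t0 <= t)%N -> j \in S t -> e t j i -> i \in S t.+1) ->
  forall i, i \in S (t0 + (m.+1 * b).+1)%N.
Proof.
move=> b0 i0S Smono Sedge.
have Sle t t' i : (t0 <= t)%N -> (t <= t')%N -> i \in S t -> i \in S t'.
  move=> t0t /subnKC <- iS.
  elim: (t' - t)%N => [|d IHd]; first by rewrite addn0.
  rewrite addnS; apply: (fintype.subsetP (Smono _ _)) => //.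
  by rewrite (leq_trans t0t)// leq_addr.
pose w n := (((t0 %/ b).+1 + n) * b)%N.
have w_ge n : (t0 <= (w n).+1)%N.
  rewrite /w ltnW// ltnS mulnDl (leq_trans _ (leq_addr _ _))//.
  by rewrite ltnW// ltn_ceil.
have w_le n : ((w n).+1 <= (w n.+1).+1)%N.
  by rewrite /w ltnS leq_mul2r leq_add2l leqnSn orbT.
have wP n : (forall i, i \in S (w n).+1) \/ (n < #|S (w n).+1|)%N.
  elim: n => [|n [SwT|nS]].
  - by right; apply/card_gt0P; exists i0; exact: Sle i0S.
  - by left=> i; exact: Sle (SwT i).
  have [/forallP SwT|/forallPn[y yS]] := boolP [forall i, i \in S (w n).+1].
    by left=> i; exact: Sle (SwT i).
  right; have /card_gt0P[x xS] : (0 < #|S (w n).+1|)%N.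
    exact: leq_ltn_trans nS.
  have [u [v [uS vS /existsP[s uv]]]] :=
    connect_exit (connected_window ((t0 %/ b).+1 + n)%N x y) xS yS.
  rewrite -/(w n) in uv.
  apply: leq_ltn_trans nS _; apply: proper_card; rewrite fintype.properE.
  apply/andP; split; first by apply/fintype.subsetP => i; exact: Sle.
  apply/subsetPn; exists v => //.
  have wt : ((w n).+1 <= w n + s.+1)%N by rewrite addnS ltnS leq_addr.
  have t0t := leq_trans (w_ge n) wt.
  apply: Sle (Sedge _ _ _ t0t (Sle _ _ _ _ wt uS) uv) => //.
    exact: leq_trans t0t _.
  rewrite ltnS /w [(_ + n.+1)%N]addnS mulSn [leqRHS]addnC leq_add2l.
  exact: ltn_ord.
move=> i; have wi : i \in S (w m).+1.
  have [//|] := wP m.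
  by rewrite ltnNge -[X in (_ <= X)%N]card_ord max_card.
apply: Sle wi => //; rewrite addnS ltnS /w addSn -addnS mulnDl leq_add2r.
exact: leq_divM.
Qed.

End Spread.

(** * Averaging and the diameter of a family of points *)

Section Mixing.
Context (R : realType) (B : normedModType R) (m : nat).
Implicit Types (A : 'M[R]_m) (x y : 'I_m -> B).

Definition row_stochastic A : Prop :=
  (forall i j, 0 <= A i j) /\ (forall i, \sum_j A i j = 1).

Definition mix A x (i : 'I_m) : B := \sum_j A i j *: x j.

Definition diam x : R := \big[Num.max/0]_i \big[Num.max/0]_j `|x i - x j|.

Lemma le_diam x i j : `|x i - x j| <= diam x.
Proof.
rewrite /diam (le_trans _ (le_bigmax _ _ i))//=.
exact: (le_trans _ (le_bigmax _ _ j)).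
Qed.

Lemma diam_le x c : 0 <= c -> (forall i j, `|x i - x j| <= c) -> diam x <= c.
Proof.
move=> c0 xc; apply: bigmax_le => // i _.
by apply: bigmax_le => // j _; exact: xc.
Qed.

Lemma diam_ge0 x : 0 <= diam x.
Proof.
rewrite /diam; elim/big_rec: _ => // i y _ y0.
by rewrite le_max y0 orbT.
Qed.

Lemma mix_mulmx A A' x i : mix (A *m A') x i = mix A (mix A' x) i.
Proof.
rewrite /mix; under eq_bigr do rewrite mxE scaler_suml.
rewrite exchange_big; apply: eq_bigr => j _ /=.
by rewrite scaler_sumr; apply: eq_bigr => k _; rewrite scalerA.
Qed.

Lemma mix_dist A x y i c : row_stochastic A ->
  (forall j, `|x j - y j| <= c) -> `|mix A x i - mix A y i| <= c.
Proof.
move=> [A0 A1] xyc; rewrite -sumrB (le_trans (ler_norm_sum _ _ _))//.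
rewrite -[c]mul1r -(A1 i) mulr_suml ler_sum// => j _.
by rewrite -scalerBr normrZ ger0_norm// ler_wpM2l.
Qed.

(** The difference of two averages is an average of the differences [x j - x j']
    with product weights [A i j * A k j'].  The pair [(j0, j0)] contributes
    nothing, which saves at least [gamma ^+ 2] of the total weight. *)
Lemma mix_contract A x i k j0 (gamma : R) : row_stochastic A -> 0 <= gamma ->
  gamma <= A i j0 -> gamma <= A k j0 ->
  `|mix A x i - mix A x k| <= (1 - gamma ^+ 2) * diam x.
Proof.
move=> [A0 A1] g0 gi gk.
have -> : mix A x i - mix A x k =
    \sum_j \sum_j' (A i j * A k j') *: (x j - x j').
  under [RHS]eq_bigr do (under eq_bigr do rewrite scalerBr; rewrite sumrB).
  rewrite sumrB; congr (_ - _).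
    by apply: eq_bigr => j _; rewrite -scaler_suml -mulr_sumr A1 mulr1.
  rewrite exchange_big; apply: eq_bigr => j _ /=.
  by rewrite -scaler_suml -mulr_suml A1 mul1r.
(* The weight [gamma ^+ 2] is removed at the single pair [(j0, j0)], so that the
   comparison can be made term by term. *)
have -> : (1 - gamma ^+ 2) * diam x =
    \sum_j \sum_j' (A i j * A k j'
      - gamma * (j == j0)%:R * (gamma * (j' == j0)%:R)) * diam x.
  have sum_delta : \sum_j gamma * (j == j0)%:R = gamma.
    rewrite -mulr_sumr (bigD1 j0)//= eqxx big1 ?addr0 ?mulr1// => j /negPf ->.
    by [].
  under eq_bigr do (rewrite -mulr_suml sumrB).
  by rewrite -mulr_suml sumrB -!big_distrlr/= !A1 sum_delta mulr1 expr2.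
rewrite (le_trans (ler_norm_sum _ _ _))// ler_sum// => j _.
rewrite (le_trans (ler_norm_sum _ _ _))// ler_sum// => j' _.
rewrite normrZ ger0_norm ?mulr_ge0//.
have [->|jj0] := eqVneq j j0; have [->|jj0'] := eqVneq j' j0; last 3 first.
- by rewrite !mulr0 subr0 ler_wpM2l ?le_diam// mulr_ge0.
- by rewrite !(mulr0, mul0r) subr0 ler_wpM2l ?le_diam// mulr_ge0.
- by rewrite !(mulr0, mul0r) subr0 ler_wpM2l ?le_diam// mulr_ge0.
rewrite subrr normr0 mulr0 mulr_ge0 ?diam_ge0// !mulr1 subr_ge0.
exact: ler_pM.
Qed.

End Mixing.

(** * Consensus over the network *)

Section Transition.
Context (R : realType) (m : nat).
Variables (P : nat -> 'M[R]_m) (b : nat) (zeta : R).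
Hypothesis P_graph : graph_assumption P b zeta.

(** The product of the mixing matrices of times [t, ..., t + s - 1], the latest
    on the left. *)
Fixpoint transition (t s : nat) : 'M[R]_m :=
  if s is s'.+1 then P (t + s')%N *m transition t s' else 1%:M.

Lemma graph_row_stochastic t : (0 < t)%N -> row_stochastic (P t).
Proof. by case: P_graph => Pds _ _ _ _ /Pds[]. Qed.

Lemma transition_row_stochastic t s : (0 < t)%N ->
  row_stochastic (transition t s).
Proof.
move=> t0; elim: s => [|s [IH0 IH1]] /=.
  split=> [i j|i]; first by rewrite mxE ler0n.
  rewrite (bigD1 i)//= mxE eqxx big1 ?addr0// => j ji.
  by rewrite mxE eq_sym (negPf ji).
have [P0 P1] : row_stochastic (P (t + s)%N).
  by apply: graph_row_stochastic; rewrite ltn_addr.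
split=> [i j|i]; first by rewrite mxE sumr_ge0// => k _; rewrite mulr_ge0.
under eq_bigr do rewrite mxE.
rewrite exchange_big -[RHS](P1 i); apply: eq_bigr => k _ /=.
by rewrite -mulr_sumr IH1 mulr1.
Qed.

(** The delay after which [spread_everywhere] reaches all agents. *)
Definition mixing_time := (m.+1 * b).+1.

(** Follow column [j] of the products: an entry that is at least [zeta ^+ s]
    after [s] steps is passed on along every edge, self-loops included, at the cost of a
    factor [zeta].  The rows with such an entry therefore spread through the
    graph until they are all of them. *)
Lemma transition_ge t i j : (0 < t)%N ->
  zeta ^+ mixing_time <= transition t mixing_time i j.
Proof.
move=> t0; case: P_graph => _ [b0 conn] /andP[z0 _] Pii Pij.
pose S tau := finset (fun k => zeta ^+ (tau - t) <= transition t (tau - t) k j).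
have step tau k l : (t <= tau)%N -> k \in S tau -> zeta <= P tau l k ->
    l \in S tau.+1.
  rewrite !finset.in_set => t_tau kS Plk.
  rewrite subSn//= subnKC// mxE (bigD1 k)//= exprS.
  have tau0 : (0 < tau)%N by exact: leq_trans t_tau.
  have [P0 _] := graph_row_stochastic tau0.
  have [T0 _] := transition_row_stochastic (tau - t) t0.
  rewrite -[leLHS]addr0 lerD ?sumr_ge0// => [|k' _]; last by rewrite mulr_ge0.
  by rewrite ler_pM ?exprn_ge0// ltW.
have := spread_everywhere (e := fun tau => edge (P tau)) conn (S := S) (t0 := t)
  (i0 := j) b0.
move=> /(_ _ _ _ i); rewrite !finset.in_set addKn; apply.
- by rewrite subnn /= mxE eqxx expr0.
- move=> tau t_tau; apply/fintype.subsetP => k kS.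
  by apply: (step _ _ _ t_tau kS (Pii _ _ _)); exact: leq_trans t_tau.
- move=> tau k l t_tau lS lk; apply: (step _ _ _ t_tau lS (Pij _ _ _ _ lk)).
  exact: leq_trans t_tau.
Qed.

Lemma mixing_rate_gt0 : 0 < (zeta ^+ mixing_time) ^+ 2.
Proof. by case: P_graph => _ _ /andP[z0 _] _ _; rewrite !exprn_gt0. Qed.

End Transition.

(** Sum the contraction inequality over [t]: the shifted sum misses only the
    first [L] terms of the original one, so the contracted fraction [g] of the sum is
    paid for by those terms and by the errors [K]. *)
Lemma sum_contraction (R : realFieldType) (d : nat -> R) (L T : nat)
    (g M K : R) :
  (forall t, 0 <= d t) ->
  (forall t, (0 < t)%N -> d (t + L)%N <= (1 - g) * d t + K) ->
  (forall t, (0 < t)%N -> (t <= L)%N -> d t <= M) ->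
  g * (\sum_(1 <= t < T.+1) d t) <= L%:R * M + T%:R * K.
Proof.
move=> d0 dL dM.
have head : \sum_(1 <= t < L.+1) d t <= L%:R * M.
  have -> : L%:R * M = \sum_(1 <= t < L.+1) M.
    by rewrite big_const_nat subn1 /= iter_addr addr0 mulr_natl.
  by apply: ler_sum_nat => t /andP[t0 tL]; exact: dM.
have tail : \sum_(1 <= t < T.+1) d (t + L)%N <=
    (1 - g) * (\sum_(1 <= t < T.+1) d t) + T%:R * K.
  have -> : T%:R * K = \sum_(1 <= t < T.+1) K.
    by rewrite big_const_nat subn1 /= iter_addr addr0 mulr_natl.
  rewrite mulr_sumr -big_split/=.
  by apply: ler_sum_nat => t /andP[t0 _]; exact: dL.
have : \sum_(1 <= t < T.+1) d t <=
    \sum_(1 <= t < L.+1) d t + \sum_(1 <= t < T.+1) d (t + L)%N.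
  have -> : \sum_(1 <= t < T.+1) d (t + L)%N = \sum_(L.+1 <= t < T.+1 + L) d t.
    by rewrite -[L.+1]add1n -{2}[L]add0n big_addn addnK.
  rewrite -big_cat_nat ?addSn ?ltnS ?leq_addl//=.
  rewrite (big_cat_nat _ (n := T.+1) (p := (T + L).+1))//= ?ltnS ?leq_addr//.
  by rewrite lerDl sumr_ge0.
by lra.
Qed.

Section Consensus.
Context (R : realType) (B : normedModType R) (m : nat).
Variables (P : nat -> 'M[R]_m) (b : nat) (zeta : R).
Hypothesis P_graph : graph_assumption P b zeta.
Variables (x y : nat -> 'I_m -> B) (eps : R).
Hypothesis eps_ge0 : 0 <= eps.
Local Notation L := (mixing_time m b).
Hypothesis x_mix : forall t, (0 < t)%N -> x t.+1 = mix (P t) (y t).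
Hypothesis y_near : forall t i, (0 < t)%N -> `|y t i - x t i| <= eps.

(** The errors only add up, since averaging does not expand distances. *)
Lemma perturbed_mix t s i : (0 < t)%N ->
  `|x (t + s)%N i - mix (transition P t s) (x t) i| <= s%:R * eps.
Proof.
move=> t0; elim: s i => [|s IHs] i.
  rewrite addn0 /mix (bigD1 i)//= mxE eqxx scale1r big1.
    by rewrite addr0 subrr normr0 mul0r.
  by move=> j ji; rewrite mxE eq_sym (negPf ji) scale0r.
have ts0 : (0 < t + s)%N by rewrite ltn_addr.
rewrite addnS x_mix//= mix_mulmx; apply: mix_dist => [|j].
  exact: (graph_row_stochastic P_graph).
rewrite (le_trans (ler_distD (x (t + s)%N j) _ _))//.
by rewrite -natr1 mulrDl mul1r addrC lerD// y_near.
Qed.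

Lemma diam_perturbed t s c : (0 < t)%N -> 0 <= c ->
  (forall i k, `|mix (transition P t s) (x t) i
                 - mix (transition P t s) (x t) k| <= c) ->
  diam (x (t + s)%N) <= c + 2 * (s%:R * eps).
Proof.
move=> t0 c0 mc; apply: diam_le => [|i k]; last first.
  have := perturbed_mix s i t0; have := perturbed_mix s k t0; have := mc i k.
  move: (mix _ _ i) (mix _ _ k) => u v uv xk xi.
  have := ler_distD u (x (t + s)%N i) (x (t + s)%N k).
  have := ler_distD v u (x (t + s)%N k).
  by move: xk; rewrite [`|_ k - v|]distrC; lra.
by rewrite addr_ge0// !mulr_ge0.
Qed.

Lemma diam_drift t s : (0 < t)%N ->
  diam (x (t + s)%N) <= diam (x t) + 2 * (s%:R * eps).
Proof.
move=> t0; apply: diam_perturbed => // [|i k]; first exact: diam_ge0.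
have A := transition_row_stochastic P_graph s t0.
have -> : diam (x t) = (1 - 0 ^+ 2) * diam (x t) by rewrite expr0n subr0 mul1r.
by apply: (mix_contract _ (j0 := i)) => //; case: A.
Qed.

Lemma diam_contract t : (0 < t)%N ->
  diam (x (t + L)%N) <=
  (1 - (zeta ^+ L) ^+ 2) * diam (x t) + 2 * (L%:R * eps).
Proof.
move=> t0; have A := transition_row_stochastic P_graph L t0.
have z0 : 0 <= zeta by case: P_graph => _ _ /andP[/ltW].
have mc i k : `|mix (transition P t L) (x t) i - mix (transition P t L) (x t) k|
    <= (1 - (zeta ^+ L) ^+ 2) * diam (x t).
  apply: (mix_contract _ (j0 := i)) => //; first exact: exprn_ge0.
    exact: (transition_ge P_graph).
  exact: (transition_ge P_graph).
apply: diam_perturbed => //.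
rewrite mulr_ge0 ?diam_ge0// subr_ge0 !exprn_ile1 ?exprn_ge0//.
by case: P_graph => _ _ /andP[_ /ltW].
Qed.

Lemma sum_diam T :
  (zeta ^+ L) ^+ 2 * (\sum_(1 <= t < T.+1) diam (x t)) <=
  L%:R * (diam (x 1%N) + 2 * (L%:R * eps)) + T%:R * (2 * (L%:R * eps)).
Proof.
apply: sum_contraction => [t|t|[//|t] _ tL].
- exact: diam_ge0.
- exact: diam_contract.
rewrite -add1n (le_trans (diam_drift _ _))// lerD2l ler_wpM2l//.
by rewrite ler_wpM2r// ler_nat ltnW.
Qed.

End Consensus.

(** * Regret of the distributed algorithm *)

Lemma convex_set_mix (R : realType) (B : normedModType R) (W : set B) m
    (A : 'M[R]_m) (x : 'I_m -> B) i :
  convex_set W -> row_stochastic A -> (forall j, W (x j)) -> W (mix A x i).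
Proof.
move=> Wc [A0 A1] Wx.
(* Dividing by partial sums of weights is avoided by an induction in which each
   partial sum of points is the partial sum of weights times a point of [W]. *)
suff [w Ww xw] : exists2 w, W w & mix A x i = (\sum_j A i j) *: w.
  by rewrite xw A1 scale1r.
rewrite /mix; elim: (index_enum _) => [|j s [w Ww IHs]].
  by exists (x i) => //; rewrite !big_nil scale0r.
rewrite !big_cons IHs; set c := \sum_(j <- s) A i j.
have c0 : 0 <= c by rewrite sumr_ge0.
have [Ac0|Ac_neq0] := eqVneq (A i j + c) 0.
  have /andP[/eqP -> /eqP ->] : (A i j == 0) && (c == 0).
    by rewrite -paddr_eq0 ?Ac0 ?eqxx.
  by exists w => //; rewrite addr0 !scale0r addr0.
have Ac : 0 < A i j + c by rewrite lt_neqAle eq_sym Ac_neq0 addr_ge0.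
exists ((A i j / (A i j + c)) *: x j + (1 - A i j / (A i j + c)) *: w).
  apply: convex_set_lineP => //; first by rewrite divr_ge0// ltW.
  by rewrite ler_pdivrMr// mul1r lerDl.
rewrite scalerDr !scalerA mulrBr mulr1 mulrCA divff// mulr1.
by rewrite [_ + c]addrC addrK.
Qed.

Section Regret.
Context (R : realType) (B : completeNormedModType R).
Variables (W : set B) (m : nat) (J : 'I_m -> B -> R) (Psi : B -> R).
Variables (P : nat -> 'M[R]_m) (b : nat) (zeta sigma G : R) (f1 : 'I_m -> B).
Hypotheses (W_neq0 : W !=set0) (W_closed : closed W) (W_convex : convex_set W).
Hypotheses (J_convex : forall i, convex_function [set: B] (J i))
  (J_gateaux : forall i, gateaux_differentiable (J i))
  (J_bound : forall i f, W f -> `|gateaux (J i) f| <= G).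
Hypotheses (sigma_gt0 : 0 < sigma) (Psi_mirror : mirror_map sigma Psi).
Hypothesis Psi_separate : forall (f : B) (g : 'I_m -> B) (a : 'I_m -> R),
  (forall j, 0 <= a j) -> \sum_j a j = 1 ->
  bregman Psi f (\sum_j a j *: g j) <= \sum_j a j * bregman Psi f (g j).
Hypothesis P_graph : graph_assumption P b zeta.
Hypothesis f1_W : forall i, W (f1 i).
Hypotheses (fstar : B) (fstar_W : W fstar).
Variable eta : R.
Hypothesis eta_ge0 : 0 <= eta.

Let x t := dfmd W Psi J P eta f1 t.
Let y t := dfmd_local W Psi J eta (x t).

Let Psi_sc := mirror_strongly_convex Psi_mirror.

Let dfmdS t : (0 < t)%N -> x t.+1 = mix (P t) (y t).
Proof. by case: t. Qed.

Lemma dfmd_local_proj t i : is_bregman_proj W Psi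
  (mirror_inv Psi (gateaux Psi (x t i) - eta *: gateaux (J i) (x t i))) (y t i).
Proof. exact: bregman_projP W_neq0 W_closed W_convex sigma_gt0 Psi_sc _. Qed.

Lemma dfmd_in t i : (0 < t)%N -> W (x t i).
Proof.
case: t => // -[_|t _]; first exact: f1_W.
rewrite dfmdS//; apply: convex_set_mix => //.
  exact: graph_row_stochastic P_graph _ _.
by move=> j; case: (dfmd_local_proj t.+1 j).
Qed.

Lemma dfmd_local_move t i : (0 < t)%N ->
  `|y t i - x t i| <= eta * G / sigma.
Proof.
move=> t0; have xW := dfmd_in i t0.
apply: (mirror_step_move W_convex sigma_gt0 Psi_sc (mirror_gateaux Psi_mirror)
  eta_ge0 (J_bound i xW) _ xW (dfmd_local_proj t i)).
exact: mirror_invK (mirror_surjective Psi_mirror).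
Qed.

Let energy t := \sum_i bregman Psi fstar (x t i).

(** The energy is not increased by mixing: the divergence is convex in its
    second argument, and the columns of [P t] sum to [1]. *)
Lemma energyS t : (0 < t)%N ->
  energy t.+1 <= \sum_i bregman Psi fstar (y t i).
Proof.
move=> t0; have [Pds _ _ _ _] := P_graph; have [P0 P1 P1'] := Pds _ t0.
apply: (@le_trans _ _ (\sum_i \sum_j P t i j * bregman Psi fstar (y t j))).
  by apply: ler_sum => i _; rewrite dfmdS//; exact: Psi_separate.
rewrite exchange_big ler_sum// => j _ /=.
by rewrite -mulr_suml P1' mul1r.
Qed.

Lemma dfmd_step_regret t : (0 < t)%N ->
  eta * (\sum_i (J i (x t i) - J i fstar)) <=
  energy t - energy t.+1 + m%:R * (eta ^+ 2 * (G ^+ 2 / (2 * sigma))).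
Proof.
move=> t0; set c := eta ^+ 2 * _.
apply: (@le_trans _ _ (\sum_i (bregman Psi fstar (x t i)
    - bregman Psi fstar (y t i) + c))); last first.
  rewrite big_split sumrB/= sumr_const card_ord -[c *+ m]mulr_natl.
  by rewrite lerD2r lerD2l lerN2 energyS.
rewrite mulr_sumr; apply: ler_sum => i _.
have xW := dfmd_in i t0.
have q'E := mirror_invK
  (gateaux Psi (x t i) - eta *: gateaux (J i) (x t i))
  (mirror_surjective Psi_mirror).
apply: (le_trans _ (mirror_step_regret W_convex sigma_gt0 Psi_sc
  (mirror_gateaux Psi_mirror) eta_ge0 (J_bound i xW) q'E
  (dfmd_local_proj t i) fstar_W)).
apply: ler_wpM2l => //.
have := convex_subgradient (x t i) fstar (J_convex i) (J_gateaux i).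
by rewrite !dual_linearB; lra.
Qed.

Lemma dfmd_regret T :
  eta * (\sum_(1 <= t < T.+1) \sum_i (J i (x t i) - J i fstar)) <=
  \sum_i bregman Psi fstar (f1 i)
  + T%:R * (m%:R * (eta ^+ 2 * (G ^+ 2 / (2 * sigma)))).
Proof.
set c := m%:R * _.
suff : eta * (\sum_(1 <= t < T.+1) \sum_i (J i (x t i) - J i fstar)) <=
    energy 1 - energy T.+1 + T%:R * c.
  move=> /le_trans; apply; rewrite lerD2r lerBlDr lerDl sumr_ge0// => i _.
  exact: bregman_ge0 sigma_gt0 Psi_sc.
elim: T => [|T IHT]; first by rewrite big_nil mulr0 subrr mul0r addr0.
rewrite big_nat_recr//= mulrDr -natr1 mulrDl mul1r.
by have := dfmd_step_regret (ltn0Sn T); rewrite -/c; lra.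
Qed.

Lemma J_lipschitz_on i f g : W f -> J i f - J i g <= G * `|f - g|.
Proof.
move=> Wf; have := convex_subgradient f g (J_convex i) (J_gateaux i).
have := dual_le_norm (gateaux (J i) f) (f - g).
have := ler_wpM2r (normr_ge0 (f - g)) (J_bound i Wf).
have := ler_norm (gateaux (J i) f (f - g)).
by rewrite !dual_linearB; lra.
Qed.

Lemma dfmd_agent_regret (l : 'I_m) T :
  \sum_(1 <= t < T.+1) \sum_i (J i (x t l) - J i fstar) <=
  \sum_(1 <= t < T.+1) \sum_i (J i (x t i) - J i fstar)
  + m%:R * G * (\sum_(1 <= t < T.+1) diam (x t)).
Proof.
have G0 : 0 <= G by rewrite (le_trans _ (J_bound l fstar_W)).
rewrite mulr_sumr -big_split/=; apply: ler_sum_nat => t /andP[t0 _].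
have -> : m%:R * G * diam (x t) = \sum_(i < m) G * diam (x t).
  by rewrite sumr_const card_ord -[(G * _) *+ m]mulr_natl mulrA.
rewrite -big_split/=; apply: ler_sum => i _.
have := J_lipschitz_on i (x t i) (dfmd_in l t0).
by have := ler_wpM2l G0 (le_diam (x t) l i); lra.
Qed.

End Regret.

(** Jensen's inequality from the subgradient at the average, whose linear terms
    sum to [0]. *)
Lemma convex_average (R : realType) (B : normedModType R) (J : B -> R)
    (x : nat -> B) T :
  convex_function [set: B] J -> gateaux_differentiable J -> (0 < T)%N ->
  T%:R * J (T%:R^-1 *: \sum_(1 <= t < T.+1) x t) <=
  \sum_(1 <= t < T.+1) J (x t).
Proof.
move=> Jc Jd T0; set xbar := _ *: _; pose F := gateaux J xbar.
have T_neq0 : T%:R != 0 :> R by rewrite pnatr_eq0 -lt0n.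
have count (c : R) : \sum_(1 <= t < T.+1) c = T%:R * c.
  by rewrite big_const_nat subn1 /= iter_addr addr0 mulr_natl.
have Fsum : \sum_(1 <= t < T.+1) F (x t - xbar) = 0.
  rewrite -linear_sum/= sumrB big_const_nat subn1 /= iter_addr addr0.
  rewrite -[xbar *+ T]scaler_nat /xbar scalerA divff// scale1r subrr.
  exact: linear0.
have -> : T%:R * J xbar = \sum_(1 <= t < T.+1) (J xbar + F (x t - xbar)).
  by rewrite big_split/= Fsum addr0 count.
by apply: ler_sum => t _; exact: convex_subgradient.
Qed.

(** * The convergence rate *)

Theorem theorem1 (R : realType) (B : completeNormedModType R)
  (B_reflexive : reflexive_space B)
  (W : set B) (W_neq0 : W !=set0) (W_closed : closed W) (W_convex : convex_set W)
  (m : nat) (J : 'I_m -> B -> R)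
  (J_convex : forall i, convex_function [set: B] (J i))
  (J_gateaux : forall i, gateaux_differentiable (J i))
  (fstar : B) (fstar_W : W fstar)
  (fstar_min : forall f, W f -> \sum_i J i fstar <= \sum_i J i f)
  (sigma : R) (sigma_gt0 : 0 < sigma) (Psi : B -> R)
  (Psi_mirror : mirror_map sigma Psi)
  (P : nat -> 'M[R]_m) (b : nat) (zeta : R)
  (P_graph : graph_assumption P b zeta)
  (G : R) (J_bound : forall i f, W f -> `|gateaux (J i) f| <= G)
  (Psi_separate : forall (f : B) (g : 'I_m -> B) (a : 'I_m -> R),
    (forall j, 0 <= a j) -> \sum_j a j = 1 ->
    bregman Psi f (\sum_j a j *: g j) <= \sum_j a j * bregman Psi f (g j))
  (f1 : 'I_m -> B) (f1_W : forall i, W (f1 i)) :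
  forall l : 'I_m, exists C : R, 0 < C /\
    forall T : nat, (1 <= T)%N ->
      let ftilde := dfmd_average W Psi J P (Num.sqrt T%:R)^-1 f1 T l in
      \sum_i J i ftilde - \sum_i J i fstar <= C / Num.sqrt T%:R.
Proof.
move=> l.
have G_ge0 : 0 <= G by rewrite (le_trans _ (J_bound l _ fstar_W)).
pose L := mixing_time m b; pose g := (zeta ^+ L) ^+ 2.
have g_gt0 : 0 < g := mixing_rate_gt0 P_graph.
pose K := 2 * (L%:R * (G / sigma)).
have K_ge0 : 0 <= K by rewrite !mulr_ge0// invr_ge0 ltW.
(* [C1] comes from the regret of the agents at their own iterates and [C2] from
   their disagreement, where a factor [eta <= 1] has been bounded by [1]. *)
pose C1 := \sum_i bregman Psi fstar (f1 i) + m%:R * (G ^+ 2 / (2 * sigma)).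
pose C2 := m%:R * G * ((L%:R * (diam f1 + K) + K) / g).
have Psi_sc := mirror_strongly_convex Psi_mirror.
have C1_ge0 : 0 <= C1.
  rewrite addr_ge0 ?sumr_ge0// => [i _|].
    exact: bregman_ge0 sigma_gt0 Psi_sc.
  by rewrite mulr_ge0// divr_ge0 ?sqr_ge0// mulr_ge0// ltW.
have C2_ge0 : 0 <= C2.
  rewrite !mulr_ge0// ?invr_ge0 ?(ltW g_gt0)// addr_ge0// mulr_ge0//.
  by rewrite addr_ge0 ?diam_ge0.
exists (C1 + C2 + 1); split; first by rewrite ltr_wpDl// addr_ge0.
move=> T T_gt0; cbv zeta; set ftilde := dfmd_average _ _ _ _ _ _ _ _.
set r := Num.sqrt T%:R.
have r_ge1 : 1 <= r by rewrite -sqrtr1 ler_wsqrtr// ler1n.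
have r_gt0 : 0 < r by rewrite (lt_le_trans _ r_ge1).
have T_r : T%:R = r ^+ 2 by rewrite sqr_sqrtr.
pose x := dfmd W Psi J P r^-1 f1.
have eta_ge0 : 0 <= r^-1 by rewrite invr_ge0 ltW.
pose D := \sum_(1 <= t < T.+1) diam (x t).
have D_le : D <= r * ((L%:R * (diam f1 + K) + K) / g).
  have eps_ge0 : 0 <= r^-1 * G / sigma by rewrite !mulr_ge0// invr_ge0 ltW.
  have xS t : (0 < t)%N -> x t.+1 = mix (P t) (dfmd_local W Psi J r^-1 (x t)).
    by case: t.
  have := sum_diam P_graph eps_ge0 xS (fun t i => dfmd_local_move W_neq0 W_closed
    W_convex J_bound sigma_gt0 Psi_mirror P_graph f1_W eta_ge0 i (t := t)) T.
  rewrite -/L -/g -/D.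
  have -> : 2 * (L%:R * (r^-1 * G / sigma)) = r^-1 * K by rewrite /K; ring.
  change (x 1%N) with f1; rewrite T_r => gD.
  rewrite mulrA ler_pdivlMr// mulrC (le_trans gD)//.
  have -> : r ^+ 2 * (r^-1 * K) = r * K by field; rewrite gt_eqF.
  rewrite [leRHS]mulrDr lerD2r [leRHS]mulrCA ler_wpM2l//.
  have : r^-1 * K <= K by rewrite ler_piMl// invf_le1.
  have : diam f1 + K <= r * (diam f1 + K).
    by rewrite ler_peMl// addr_ge0 ?diam_ge0.
  by lra.
have regret := dfmd_regret W_neq0 W_closed W_convex J_convex J_gateaux J_bound
  sigma_gt0 Psi_mirror Psi_separate P_graph f1_W fstar_W eta_ge0 T.
have agent := dfmd_agent_regret W_neq0 W_closed W_convex J_convex J_gateaux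
  J_bound sigma_gt0 Psi_mirror P_graph f1_W fstar_W r^-1 l T.
rewrite -/x -/D in regret agent.
move: regret agent; set S := \sum_(_ <= _ < _) _ => regret.
set Sl := \sum_(_ <= _ < _) _ => agent.
have S_le : S <= r * C1.
  rewrite -ler_pdivrMl//; apply: (le_trans regret).
  by rewrite T_r /C1 lerD2l le_eqVlt; apply/orP; left; apply/eqP; field;
    rewrite !gt_eqF.
have average : T%:R * (\sum_i J i ftilde - \sum_i J i fstar) <= Sl.
  rewrite -sumrB mulr_sumr /Sl exchange_big/=; apply: ler_sum => i _.
  rewrite sumrB big_const_nat subn1 /= iter_addr addr0 mulrBr.
  by rewrite [X in _ - X]mulr_natl lerD2r; exact: convex_average.
have Sl_le : Sl <= r * (C1 + C2).
  apply: (le_trans agent).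
  have := ler_wpM2l (mulr_ge0 (ler0n R m) G_ge0) D_le.
  by move: S_le; rewrite /C2; lra.
rewrite ler_pdivlMr// -(ler_pM2l r_gt0).
have := le_trans average Sl_le; rewrite T_r => avg.
have : r * (C1 + C2) <= r * (C1 + C2 + 1) by rewrite ler_pM2l// lerDl.
move: avg; move: (\sum_i _ - _) => z; lra.
Qed.
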